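(* Let $p$ be a prime and let $G = C_p\times C_p$. Every supercharacter theory of $G$ that can be realized as a $\ast$-product $\mathsf{U}\ast\mathsf{V}$ (where $N$ is a nontrivial proper subgroup of $G$, $\mathsf{U}$ is a supercharacter theory of $N$, and $\mathsf{V}$ is a supercharacter theory of $G/N$), or as a direct product $\mathsf{E}\times\mathsf{F}$ (where $H, K$ are nontrivial proper subgroups with $G=H\times K$, $\mathsf{E}$ is a supercharacter theory of $H$, and $\mathsf{F}$ is a supercharacter theory of $K$), comes from automorphisms.
   Context: A supercharacter theory of a finite group $G$ is a pair $\mathsf{S}=(\mathcal{X},\mathcal{K})$, where $\mathcal{X}$ is a partition of $\mathrm{Irr}(G)$ and $\mathcal{K}$ is a partition of $G$, such that $|\mathcal{X}|=|\mathcal{K}|$, $\{1\}\in\mathcal{K}$, and for every $X\in\mathcal{X}$ there is a (nonzero) character $\xi_X$ whose irreducible constituents lie in $X$ and which is constant on each part of $\mathcal{K}$. The parts of $\mathcal{K}$ are the $\mathsf{S}$-classes (superclasses), and $\mathrm{Cl}(\mathsf{S})=\mathcal{K}$. A supercharacter theory is uniquely determined by its superclasses. $\mathsf{S}$ comes from automorphisms if there is a subgroup $A\le\mathrm{Aut}(G)$ such that the $\mathsf{S}$-classes are exactly the orbits of $A$ on $G$ (equivalently, $\mathcal{K}$ and $\mathcal{X}$ are the sets of $A$-orbits on $G$ and on $\mathrm{Irr}(G)$). For $G$ abelian, $N\le G$, $\mathsf{U}$ a supercharacter theory of $N$ and $\mathsf{V}$ a supercharacter theory of $G/N$, the $\ast$-product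 $\mathsf{U}\ast\mathsf{V}$ is the supercharacter theory of $G$ whose superclasses are the $\mathsf{U}$-classes together with the full preimages in $G$ of the nonidentity $\mathsf{V}$-classes under $G\to G/N$. If $G=H\times K$, $\mathsf{E}$ is a supercharacter theory of $H$ and $\mathsf{F}$ is a supercharacter theory of $K$, the direct product $\mathsf{E}\times\mathsf{F}$ is the supercharacter theory of $G$ whose superclasses are the sets $A\times B$ with $A\in\mathrm{Cl}(\mathsf{E})$ and $B\in\mathrm{Cl}(\mathsf{F})$. *)

(* Defs.v *)
From HB Require Import structures.
From mathcomp Require Import all_boot all_order all_fingroup all_algebra.
From mathcomp Require Import all_solvable all_field all_character.

Set Implicit Arguments.
Unset Strict Implicit.
Unset Printing Implicit Defensive.

Import GroupScope GRing.Theory.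

Record supercharTheory (gT : finGroupType) (G : {group gT}) := SupercharTheory {
  sc_chars : {set {set Iirr G}};
  sc_classes : {set {set gT}};
  sc_chars_partition : partition sc_chars [set: Iirr G];
  sc_classes_partition : partition sc_classes G;
  sc_card : #|sc_chars| = #|sc_classes|;
  sc_class1 : [set 1] \in sc_classes;
  sc_constant : forall X, X \in sc_chars ->
    exists xi : 'CF(G), [/\ xi \is a character, xi != 0%R,
      {subset irr_constt xi <= X} &
      forall K, K \in sc_classes -> {in K &, forall x y, xi x = xi y}]
}.

Definition from_automorphisms (gT : finGroupType) (G : {group gT})
    (S : supercharTheory G) : Prop :=
  exists2 A : {group {perm gT}}, A \subset Aut G &
    sc_classes S = [set orbit 'P A x | x in G].

(* A supercharacter theory is determined by its superclasses, so the products
   below are characterised by their superclasses alone. *)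
Definition is_star_product (gT : finGroupType) (G N : {group gT})
    (S : supercharTheory G) (U : supercharTheory N)
    (V : supercharTheory (G / N)%G) : Prop :=
  sc_classes S =
    sc_classes U :|:
    [set [set x in G | coset N x \in (B : {set coset_of N})]
      | B in sc_classes V :\ [set 1]].

(* For an internal direct product H \x K = G the set A x B is A * B. *)
Definition is_direct_product (gT : finGroupType) (G H K : {group gT})
    (S : supercharTheory G) (E : supercharTheory H)
    (F : supercharTheory K) : Prop :=
  sc_classes S = [set (A : {set gT}) * (B : {set gT}) | A in sc_classes E, B in sc_classes F].

Definition star_decomposable (gT : finGroupType) (G : {group gT})
    (S : supercharTheory G) : Prop :=
  exists N : {group gT},
    [/\ N :!=: 1, N \proper G &
        exists (U : supercharTheory N) (V : supercharTheory (G / N)%G),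
          is_star_product S U V].

Definition direct_decomposable (gT : finGroupType) (G : {group gT})
    (S : supercharTheory G) : Prop :=
  exists H K : {group gT},
    [/\ H :!=: 1 /\ H \proper G, K :!=: 1 /\ K \proper G, H \x K = G &
        exists (E : supercharTheory H) (F : supercharTheory K),
          is_direct_product S E F].

(* Main.v *)
Require Import Defs.
From mathcomp Require Import all_boot all_order all_fingroup all_algebra.
From mathcomp Require Import all_solvable all_field all_character.

(** Call two elements of G equivalent when they lie in the same superclass.

    A group of prime order has no supercharacter theories besides the ones that
    come from automorphisms, and moreover each of their superclasses is an orbit
    of power maps.  Indeed the supercharacters separate the superclasses
    (supercharacters_separate), and for n coprime to #|G| a Galois automorphism
    of algC turns the value of any character at x into its value at x ^+ n
    (char_expg_aut).  Hence x ~ y implies x ^+ n ~ y ^+ n.  In prime order, two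
    equivalent nonidentity elements satisfy y = x ^+ n for some n coprime to
    #|G|, and then z ~ z ^+ n for every z, as z is itself a power of x
    (prime_superclass_expg).

    Now let G = C_p x C_p.  A supercharacter theory comes from automorphisms as
    soon as, whenever x ~ y, some automorphism of G maps x to y and each
    superclass to itself (from_automorphisms_transitive).  The
    factors of both kinds of products have prime order, so equivalence inside a
    factor is realized by power maps, and it remains to glue power maps to an
    automorphism of G.  This is possible because G is a vector space over F_p:
    any basis can be sent to any other one (Aut_dprod_cycles).

    For a direct product, raise the two factors to suitable powers.  For a star
    product over N, use an automorphism that is a power map on N and that sends
    some v outside N to some w outside N (star_automorphism).  It preserves the
    superclasses when the power map on N preserves those of U and the map it
    induces on G / N is a power map preserving those of V.  Two equivalent
    elements x and y of N are treated with v = w, and two equivalent elements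
    outside N with v = x, w = y and the identity on N: there, the freedom to
    choose y anywhere in its coset of N is exactly what makes the full preimage
    of a V-class a single orbit. *)

Set Implicit Arguments.
Unset Strict Implicit.
Unset Printing Implicit Defensive.

Import GroupScope GRing.Theory.

(** * Superclasses and the functions constant on them *)

Section Superclasses.

Variables (gT : finGroupType) (G : {group gT}) (S : supercharTheory G).

Definition same_superclass (x y : gT) : Prop :=
  exists C, [/\ C \in sc_classes S, x \in C & y \in C].

Lemma superclass_eq C D x :
  C \in sc_classes S -> D \in sc_classes S -> x \in C -> x \in D -> C = D.
Proof.
move=> SC SD Cx Dx; have /and3P[_ tiS _] := sc_classes_partition S.
by rewrite -(def_pblock tiS SC Cx) (def_pblock tiS SD Dx).
Qed.

Lemma superclass_sub C : C \in sc_classes S -> C \subset G.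
Proof.
move=> SC; have /and3P[/eqP <- _ _] := sc_classes_partition S.
exact: bigcup_sup.
Qed.

Lemma superclass_exists x : x \in G -> exists2 C, C \in sc_classes S & x \in C.
Proof.
have /and3P[/eqP defG _ _] := sc_classes_partition S.
by rewrite -{1}defG => /bigcupP[C]; exists C.
Qed.

Lemma superclass_repr C : C \in sc_classes S -> repr C \in C.
Proof.
move=> SC; have /and3P[_ _ S0] := sc_classes_partition S.
have /set0Pn[x Cx]: C != set0 by apply: contraNneq S0 => <-.
exact: mem_repr Cx.
Qed.

Lemma same_superclass_refl x : x \in G -> same_superclass x x.
Proof. by case/superclass_exists=> C SC Cx; exists C. Qed.

Lemma same_superclass_sym x y : same_superclass x y -> same_superclass y x.
Proof. by case=> C []; exists C. Qed.

Lemma same_superclass_mem x y : same_superclass x y -> x \in G /\ y \in G.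
Proof. by case=> C [/superclass_sub/subsetP sCG /sCG ? /sCG]. Qed.

Lemma same_superclass1 y : same_superclass 1 y -> y = 1.
Proof.
case=> C [SC C1 Cy]; apply/set1P.
by rewrite (superclass_eq (sc_class1 S) SC (set11 1) C1).
Qed.

(** The characters attached to the parts of Irr(G) have disjoint constituents,
    so they are linearly independent.  As there are as many of them as there are
    superclasses, the matrix of their values is square and invertible, and no
    two of its columns coincide. *)
Lemma supercharacters_separate (x y : gT) : x \in G -> y \in G ->
  (forall xi : 'CF(G), xi \is a character ->
     (forall C, C \in sc_classes S -> {in C &, forall s t, xi s = xi t}) ->
     xi x = xi y) ->
  same_superclass x y.
Proof.
move=> Gx Gy eq_xi; pose I := sc_chars S.
have /fin_all_exists[xi xiP]: forall X : {set Iirr G}, exists xi : 'CF(G),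
  X \in I -> [/\ xi \is a character, xi != 0%R, {subset irr_constt xi <= X} &
    forall C, C \in sc_classes S -> {in C &, forall s t, xi s = xi t}].
- move=> X; have [IX | _] := boolP (X \in I); last by exists 0%R.
  by have [xi xiP] := sc_constant IX; exists xi.
pose cl (j : 'I_#|I|) := enum_val (cast_ord (sc_card S) j).
have cl_surj C : C \in sc_classes S -> exists j, cl j = C.
  move=> SC; exists (cast_ord (esym (sc_card S)) (enum_rank_in SC C)).
  by rewrite /cl cast_ordKV enum_rankK_in.
pose M : 'M[algC]_#|I| := (\matrix_(i, j) xi (enum_val i) (repr (cl j)))%R.
have Munit : M \in unitmx.
  rewrite -row_free_unit; apply: inj_row_free => v vM0.
  have sum0: (\sum_i v 0 i *: xi (enum_val i) = 0)%R.
    apply/cfun_inP=> z Gz; rewrite cfunE.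
    have [C SC Cz] := superclass_exists Gz.
    have [j def_j] := cl_surj C SC.
    have /rowP/(_ j) := vM0; rewrite !mxE => <-.
    rewrite sum_cfunE; apply: eq_bigr => i _; rewrite cfunE mxE def_j.
    have [_ _ _ cst] := xiP _ (enum_valP i).
    by rewrite (cst C SC z (repr C) Cz) ?superclass_repr.
  apply/rowP=> i; rewrite mxE.
  have [_ nz_xi sub_xi _] := xiP _ (enum_valP i).
  have [k xi_k] := neq0_has_constt nz_xi.
  have /(congr1 (fun f => '[f, 'chi_k]%R)) := sum0.
  rewrite cfdot_suml cfdot0l (bigD1 i) //= big1 => [|j ne_ji].
    rewrite addr0 cfdotZl => /eqP.
    rewrite irr_consttE in xi_k.
    by rewrite mulf_eq0 (negPf xi_k) orbF => /eqP.
  have [_ _ sub_j _] := xiP _ (enum_valP j).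
  (* The part containing 'chi_k is enum_val i, so it is not enum_val j. *)
  have: k \notin irr_constt (xi (enum_val j)).
    apply: contra ne_ji => /sub_j Xj_k; apply/eqP/enum_val_inj.
    have /and3P[_ tiI _] := sc_chars_partition S.
    rewrite -(def_pblock tiI (enum_valP j) Xj_k).
    by rewrite (def_pblock tiI (enum_valP i) (sub_xi k xi_k)).
  by rewrite irr_consttE negbK cfdotZl => /eqP->; rewrite mulr0.
have [C SC Cx] := superclass_exists Gx; have [i def_i] := cl_surj C SC.
have [D SD Dy] := superclass_exists Gy; have [j def_j] := cl_surj D SD.
have: (M *m delta_mx i 0 = M *m delta_mx j (0 : 'I_1))%R.
  rewrite -!colE; apply/colP=> k; rewrite !mxE def_i def_j.
  have [Nxi _ _ cst] := xiP _ (enum_valP k).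
  rewrite (cst C SC (repr C) x) ?(cst D SD (repr D) y) ?superclass_repr //.
  exact: eq_xi.
move/(congr1 (mulmx (invmx M))); rewrite !mulKmx // => /colP/(_ i)/eqP.
rewrite !mxE !eqxx /=; have [ij _ | _] := eqVneq i j; last by rewrite oner_eq0.
by exists C; split; rewrite // -def_i ij def_j.
Qed.

End Superclasses.

(** * Power maps *)

(** Restricted to <[x]>, a character is a sum of linear characters, whose values
    are #|G|-th roots of unity; u is a field automorphism raising these to the
    n-th power. *)
Lemma char_expg_aut (gT : finGroupType) (G : {group gT}) n :
  coprime n #|G| ->
  exists u : {rmorphism algC -> algC}, forall (chi : 'CF(G)) x,
    chi \is a character -> x \in G -> chi (x ^+ n) = u (chi x).
Proof.
case/Qn_aut_exists=> u uP; exists u => chi x Nchi Gx.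
have sXG: <[x]> \subset G by rewrite cycle_subG.
rewrite -(cfResE chi sXG (cycle_id x)) -(cfResE chi sXG (mem_cycle x n)).
have /char_sum_irrP[m ->] := cfRes_char <[x]> Nchi.
rewrite !sum_cfunE rmorph_sum; apply: eq_bigr => i _.
have lin_i: ('chi[<[x]>]_i)%R \is a linear_char.
  exact: (char_abelianP _ (cycle_abelian x)).
rewrite !cfunE lin_charX ?cycle_id // rmorphM rmorph_nat uP //.
rewrite -lin_charX ?cycle_id // -(divnK (order_dvdG Gx)) mulnC expgM.
by rewrite expg_order expg1n lin_char1.
Qed.

Lemma same_superclass_expg (gT : finGroupType) (G : {group gT})
    (S : supercharTheory G) n x y :
  coprime n #|G| -> same_superclass S x y ->
  same_superclass S (x ^+ n) (y ^+ n).
Proof.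
move=> co_n xSy; have [Gx Gy] := same_superclass_mem xSy.
have [C [SC Cx Cy]] := xSy; have [u uP] := char_expg_aut co_n.
apply: supercharacters_separate; rewrite ?groupX // => xi Nxi cst.
by rewrite !uP // (cst C SC x y).
Qed.

Lemma cycle_eq_prime_group (gT : finGroupType) (G : {group gT}) x :
  prime #|G| -> x \in G -> x != 1 -> <[x]> = G.
Proof.
move=> prG Gx nt_x; apply/eqP; rewrite eqEcard cycle_subG Gx -orderE.
have /primeP[_ /(_ _ (order_dvdG Gx)) /=] := prG.
by rewrite order_eq1 (negPf nt_x) => /eqP->.
Qed.

(** The exponent n that links x to y moves every element within its superclass,
    because the power maps permute the superclasses and commute with each
    other. *)
Lemma prime_superclass_expg (gT : finGroupType) (G : {group gT})
    (S : supercharTheory G) x y :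
  prime #|G| -> same_superclass S x y ->
  exists n, [/\ coprime n #|G|, y = x ^+ n &
    forall z, z \in G -> same_superclass S z (z ^+ n)].
Proof.
move=> prG xSy; have [Gx Gy] := same_superclass_mem xSy.
have [x1 | nt_x] := eqVneq x 1.
  exists 1%N; rewrite coprime1n; split=> // [|z]; last exact: same_superclass_refl.
  by move: xSy; rewrite x1 => /same_superclass1->.
have defG := cycle_eq_prime_group prG Gx nt_x.
have /cycleP[n def_y]: y \in <[x]> by rewrite defG.
have nt_y: y != 1.
  apply: contraNneq nt_x => y1; rewrite y1 in xSy.
  exact/eqP/same_superclass1/(same_superclass_sym xSy).
have co_n: coprime n #|G|.
  rewrite coprime_sym prime_coprime //; apply: contra nt_y => dv_n.
  by rewrite def_y -order_dvdn orderE defG.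
exists n; split=> // z Gz.
have /cycleP[i ->]: z \in <[x]> by rewrite defG.
(* Either z = 1, or raising x ~ y to the power i gives z ~ z ^+ n. *)
have [p_i | co_i] := boolP (#|G| %| i).
  rewrite (_ : x ^+ i = 1) ?expg1n; first exact: same_superclass_refl.
  by apply/eqP; rewrite -order_dvdn orderE defG.
rewrite expgAC -def_y; apply: same_superclass_expg => //.
by rewrite coprime_sym prime_coprime.
Qed.

(** * Automorphisms preserving the superclasses *)

(** The group to use is the largest possible one, the automorphisms of G that
    stabilize every superclass. *)
Lemma from_automorphisms_transitive (gT : finGroupType) (G : {group gT})
    (S : supercharTheory G) :
  (forall x y, same_superclass S x y -> exists s,
     [/\ s \in Aut G, s x = y & forall z, z \in G -> same_superclass S z (s z)]) ->
  from_automorphisms S.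
Proof.
move=> trS; exists 'C_(Aut_group G)(sc_classes S | 'P^*)%G; first exact: subsetIl.
set A := ('C_(_)(_ | _))%G.
have orbitA C x : C \in sc_classes S -> x \in C -> orbit 'P A x = C.
  move=> SC Cx; apply/setP=> y; apply/orbitP/idP=> [[s As <-] | Cy].
    have /setIP[_ /astabP/(_ C SC) eq_Cs] := As.
    by rewrite -eq_Cs; exact: imset_f.
  have [|s [AutGs <- presS]] := trS x y; first by exists C.
  exists s => //; rewrite inE AutGs; apply/astabP=> D SD; apply/eqP.
  rewrite eqEcard card_setact leqnn andbT; apply/subsetP=> _ /imsetP[z Dz ->].
  have [|E [SE Ez Esz]] := presS z; first exact: (subsetP (superclass_sub SD)).
  by rewrite (superclass_eq SD SE Dz Ez).
apply/setP=> C; apply/idP/imsetP=> [SC | [x Gx ->]].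
  have Cx := superclass_repr SC; exists (repr C); last by rewrite (orbitA C).
  exact: (subsetP (superclass_sub SC)).
by have [D SD Dx] := superclass_exists S Gx; rewrite (orbitA D).
Qed.

(** * Elementary abelian groups of rank two *)

Lemma Aut_dprod_cycles (gT : finGroupType) (G : {group gT}) u v u' v' :
  <[u]> \x <[v]> = G -> <[u']> \x <[v']> = G -> #[u'] = #[u] -> #[v'] = #[v] ->
  exists2 s, s \in Aut G &
    forall i j, s (u ^+ i * v ^+ j) = u' ^+ i * v' ^+ j.
Proof.
move=> defG defG' ou ov.
have dvu: #[u'] %| #[u] by rewrite ou.
have dvv: #[v'] %| #[v] by rewrite ov.
pose f := eltm_morphism dvu; pose g := eltm_morphism dvv.
have im_f: f @* <[u]> = <[u']> by rewrite morphim_cycle ?cycle_id //= eltm_id.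
have im_g: g @* <[v]> = <[v']> by rewrite morphim_cycle ?cycle_id //= eltm_id.
have [_ prodG' cuv' tiG'] := dprodP defG'.
have cfg: g @* <[v]> \subset 'C(f @* <[u]>) by rewrite im_f im_g.
pose h := dprodm_morphism defG cfg.
have im_h: h @* G = G by rewrite im_dprodm im_f im_g.
have inj_h: 'injm h.
  by rewrite injm_dprodm !injm_eltm ou ov !dvdnn im_f im_g tiG' eqxx.
exists (aut inj_h im_h) => [|i j]; first exact: Aut_aut.
have [ui vj] := (mem_cycle u i, mem_cycle v j).
rewrite autE; first by rewrite /= dprodmE //; congr (_ * _); apply: eltmE.
by have [_ <- _ _] := dprodP defG; apply: mem_mulg.
Qed.

Lemma abelem_rank2_dprod p (gT : finGroupType) (G N : {group gT}) v :
  prime p -> p.-abelem G -> #|G| = (p ^ 2)%N -> N \subset G -> #|N| = p ->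
  v \in G -> v \notin N -> N \x <[v]> = G.
Proof.
move=> p_pr abelG oG sNG oN Gv N'v.
have nt_v: v != 1 by apply: contraNneq N'v => ->.
have tiNv: N :&: <[v]> = 1.
  by rewrite setIC prime_TIg ?cycle_subG // -orderE (abelem_order_p abelG).
have cNv: <[v]> \subset 'C(N).
  by apply: (centsS sNG); rewrite cycle_subG (subsetP (abelem_abelian abelG)).
rewrite dprodE //; apply/eqP; rewrite eqEcard mul_subG ?cycle_subG //.
by rewrite TI_cardMg //= oG oN -orderE (abelem_order_p abelG Gv nt_v) mulnn.
Qed.

Lemma abelem_Zp2 p (gT : finGroupType) (G : {group gT}) :
  prime p -> G \isog [set: 'Z_p * 'Z_p] -> p.-abelem G /\ #|G| = (p ^ 2)%N.
Proof.
move=> p_pr isoG; have oZp: #|[set: 'Z_p]| = p.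
  by rewrite cardsT card_ord Zp_cast ?prime_gt1.
split; last first.
  by rewrite (card_isog isoG) cardsT card_prod -cardsT oZp mulnn.
rewrite (isog_abelem isoG) abelemE //; apply/andP; split.
  apply/centsP=> [[a b] _ [c d] _]; rewrite /commute.
  by congr pair; apply: Zp_mulgC.
apply/exponentP=> [[a b] _].
have expZp (c : 'Z_p) : c ^+ p = 1.
  by rewrite -[RHS](expg_cardG (in_setT c)) oZp.
have expg_pair n : (a, b) ^+ n = (a ^+ n, b ^+ n).
  by elim: n => // n IHn; rewrite !expgS IHn.
by rewrite expg_pair !expZp.
Qed.

Lemma card_proper_rank2 p (gT : finGroupType) (G N : {group gT}) :
  prime p -> #|G| = (p ^ 2)%N -> N :!=: 1 -> N \proper G -> #|N| = p.
Proof.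
move=> p_pr oG ntN /properP[sNG [x Gx N'x]].
have := cardSg sNG; rewrite oG => /(dvdn_pfactor _ _ p_pr)[[|[|[|//]]]] //= _ oN.
  by case/negP: ntN; rewrite trivg_card1 oN.
by case/negP: N'x; have /eqP-> : N :==: G by rewrite eqEcard sNG oN oG /=.
Qed.

Lemma cycle_expg_coprime (gT : finGroupType) (x : gT) n :
  coprime n #[x] -> <[x ^+ n]> = <[x]>.
Proof. by rewrite coprime_sym -generator_coprime => /eqP. Qed.

(** * Star products *)

Section StarProduct.

Variables (gT : finGroupType) (G N : {group gT}) (S : supercharTheory G).
Variables (U : supercharTheory N) (V : supercharTheory (G / N)%G).
Hypotheses (nsNG : N <| G) (starS : is_star_product S U V).

Lemma star_same_sub x y : same_superclass U x y -> same_superclass S x y.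
Proof. by case=> C [UC Cx Cy]; exists C; rewrite starS inE UC. Qed.

Lemma star_same_quo x y : x \in G -> y \in G -> x \notin N ->
  same_superclass V (coset N x) (coset N y) -> same_superclass S x y.
Proof.
move=> Gx Gy N'x [B [VB Bx By]]; exists [set z in G | coset N z \in B].
rewrite !inE Gx Gy Bx By; split=> //.
rewrite starS inE imset_f ?orbT // !inE VB andbT.
apply: contraNneq N'x => B1; move: Bx; rewrite B1 => /set1P/coset_idr; apply.
by rewrite (subsetP (normal_norm nsNG)).
Qed.

Lemma star_sameP x y : same_superclass S x y ->
  same_superclass U x y \/
  [/\ x \in G, y \in G, x \notin N, y \notin N &
      same_superclass V (coset N x) (coset N y)].
Proof.
case=> C []; rewrite starS inE => /orP[UC Cx Cy | /imsetP[B]].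
  by left; exists C.
rewrite !inE => /andP[nt_B VB] -> /[!inE] /andP[Gx Bx] /andP[Gy By].
have N'B z : coset N z \in B -> z \notin N.
  move=> Bz; apply: contra nt_B => Nz; rewrite coset_id // in Bz.
  by rewrite (superclass_eq VB (sc_class1 V) Bz (set11 1)).
by right; split; rewrite ?N'B //; exists B.
Qed.

End StarProduct.

(** Send a generator u of N to u ^+ n and v to w.  Elements of N then move inside
    their U-class, while an element u ^+ i * v ^+ j outside N is mapped to the
    coset (coset N v) ^+ (m * j), that is, to the m-th power of its own coset,
    which is all that its superclass depends on. *)
Lemma star_automorphism p (gT : finGroupType) (G N : {group gT})
    (S : supercharTheory G) (U : supercharTheory N)
    (V : supercharTheory (G / N)%G) n m v w :
  prime p -> p.-abelem G -> #|G| = (p ^ 2)%N -> N \subset G -> #|N| = p ->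
  is_star_product S U V -> coprime n p ->
  (forall z, z \in N -> same_superclass U z (z ^+ n)) ->
  (forall c, c \in G / N -> same_superclass V c (c ^+ m)) ->
  v \in G -> v \notin N -> w \in G -> w \notin N -> coset N w = coset N v ^+ m ->
  exists s, [/\ s \in Aut G, {in N, forall z, s z = z ^+ n}, s v = w &
    forall z, z \in G -> same_superclass S z (s z)].
Proof.
move=> p_pr abelG oG sNG oN starS co_n powU powV Gv N'v Gw N'w cosets_vw.
have nsNG: N <| G by rewrite -sub_abelian_normal ?(abelem_abelian abelG).
have sGnN := subsetP (normal_norm nsNG).
have [u Nu nt_u]: exists2 u, u \in N & u != 1.
  by apply/trivgPn; rewrite -cardG_gt1 oN prime_gt1.
have defN: <[u]> = N by apply: cycle_eq_prime_group; rewrite ?oN.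
have ou: #[u] = p by rewrite orderE defN.
have co_u: <[u ^+ n]> = N by rewrite cycle_expg_coprime ?ou.
have dprodN t : t \in G -> t \notin N -> N \x <[t]> = G.
  exact: (abelem_rank2_dprod p_pr abelG).
have ord_p t : t \in G -> t \notin N -> #[t] = p.
  move=> Gt N't; apply: (abelem_order_p abelG Gt).
  by apply: contraNneq N't => ->.
have [||||s AutGs s_uv] := @Aut_dprod_cycles _ G u v (u ^+ n) w.
- by rewrite defN dprodN.
- by rewrite co_u dprodN.
- by rewrite !orderE defN co_u.
- by rewrite !ord_p.
have sN: {in N, forall z, s z = z ^+ n}.
  move=> z; rewrite -defN => /cycleP[i ->].
  by have:= s_uv i 0; rewrite !expg0 !mulg1 => ->; rewrite expgAC.
exists s; split=> // [|z Gz].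
  by have:= s_uv 0 1%N; rewrite !expg0 !mul1g !expg1.
have [Nz | N'z] := boolP (z \in N).
  by rewrite sN //; apply: (star_same_sub starS); apply: powU.
apply: (star_same_quo nsNG starS) => //; first exact: Aut_closed.
have [a [b [Na vb def_z _]]] := mem_dprod (dprodN v Gv N'v) Gz.
have /cycleP[i def_a]: a \in <[u]> by rewrite defN.
have /cycleP[j def_b] := vb.
have coset_prod k t : t \in G -> coset N (u ^+ k * t ^+ j) = coset N t ^+ j.
  move=> Gt; have Nuk: u ^+ k \in N by rewrite groupX.
  have Guk := subsetP sNG _ Nuk.
  rewrite morphM ?sGnN ?(groupX j Gt) //=.
  by rewrite (coset_id Nuk) mul1g morphX ?sGnN.
rewrite def_z def_a def_b s_uv -expgM !coset_prod // cosets_vw expgAC.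
by apply: powV; rewrite groupX // mem_quotient.
Qed.

Lemma star_from_automorphisms p (gT : finGroupType) (G : {group gT})
    (S : supercharTheory G) :
  prime p -> p.-abelem G -> #|G| = (p ^ 2)%N ->
  star_decomposable S -> from_automorphisms S.
Proof.
move=> p_pr abelG oG [N [ntN prNG [U [V starS]]]].
have [sNG [v Gv N'v]] := properP prNG.
have oN := card_proper_rank2 p_pr oG ntN prNG.
have nsNG: N <| G by rewrite -sub_abelian_normal ?(abelem_abelian abelG).
have oV : #|(G / N)%G| = p.
  rewrite card_quotient ?normal_norm // -divgS // oG oN.
  by rewrite expnS expn1 mulKn ?prime_gt0.
apply: from_automorphisms_transitive => x y.
(* In N, the automorphism is a power map fixing a complement; outside N, it is
   the identity on N and moves the complement <[x]> to <[y]>. *)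
case/(star_sameP starS) => [xUy | [Gx Gy N'x N'y xVy]].
  have [|n [co_n -> powU]] := prime_superclass_expg _ xUy; first by rewrite oN.
  have [Nx _] := same_superclass_mem xUy; rewrite oN in co_n.
  have [||s [AutGs sN _ presS]] := star_automorphism (m := 1%N) p_pr abelG oG sNG oN
    starS co_n powU _ Gv N'v Gv N'v.
  - exact: same_superclass_refl.
  - by [].
  by exists s; rewrite sN.
have [|m [_ def_y powV]] := prime_superclass_expg _ xVy; first by rewrite oV.
have [|s [AutGs _ sx presS]] := star_automorphism p_pr abelG oG sNG oN
  starS (coprime1n p) _ powV Gx N'x Gy N'y def_y.
  exact: same_superclass_refl.
by exists s.
Qed.

(** * Direct products *)

Lemma direct_from_automorphisms p (gT : finGroupType) (G : {group gT})
    (S : supercharTheory G) :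
  prime p -> #|G| = (p ^ 2)%N ->
  direct_decomposable S -> from_automorphisms S.
Proof.
move=> p_pr oG [H [K [[ntH prHG] [ntK prKG] defG [E [F dirS]]]]].
have oH := card_proper_rank2 p_pr oG ntH prHG.
have oK := card_proper_rank2 p_pr oG ntK prKG.
have prH: prime #|H| by rewrite oH.
have prK: prime #|K| by rewrite oK.
have [u Hu nt_u] := trivgPn _ ntH; have [v Kv nt_v] := trivgPn _ ntK.
have defH := cycle_eq_prime_group prH Hu nt_u.
have defK := cycle_eq_prime_group prK Kv nt_v.
have sameM h k h' k' : same_superclass E h h' -> same_superclass F k k' ->
  same_superclass S (h * k) (h' * k').
- case=> A [EA Ah Ah'] [B [FB Bk Bk']]; exists (A * B).
  by rewrite dirS !mem_mulg ?imset2_f.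
apply: from_automorphisms_transitive => x y [C []].
rewrite dirS => /imset2P[A B EA FB ->] /mulsgP[h k Ah Bk ->] /mulsgP[h' k' Ah' Bk' ->].
have hEh': same_superclass E h h' by exists A.
have kFk': same_superclass F k k' by exists B.
have [n [co_n -> powE]] := prime_superclass_expg prH hEh'.
have [m [co_m -> powF]] := prime_superclass_expg prK kFk'.
have genH: <[u ^+ n]> = <[u]> by rewrite cycle_expg_coprime // orderE defH.
have genK: <[v ^+ m]> = <[v]> by rewrite cycle_expg_coprime // orderE defK.
have [||||s AutGs s_uv] := @Aut_dprod_cycles _ G u v (u ^+ n) (v ^+ m).
- by rewrite defH defK.
- by rewrite genH genK defH defK.
- by rewrite !orderE genH.
- by rewrite !orderE genK.
have s_hk a b : a \in H -> b \in K -> s (a * b) = a ^+ n * b ^+ m.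
  rewrite -defH -defK => /cycleP[i ->] /cycleP[j ->].
  by rewrite s_uv !(expgAC _ n) !(expgAC _ m).
exists s; split=> // [|z Gz].
  have [[Hh _] [Kk _]] := (same_superclass_mem hEh', same_superclass_mem kFk').
  exact: s_hk.
have [a [b [Ha Kb -> _]]] := mem_dprod defG Gz.
by rewrite s_hk //; apply: sameM; [apply: powE | apply: powF].
Qed.

(** * Products of supercharacter theories of C_p x C_p *)

Theorem theorem1 (p : nat) (p_pr : prime p) (gT : finGroupType)
    (G : {group gT}) (isoG : G \isog [set: 'Z_p * 'Z_p])
    (S : supercharTheory G) :
  star_decomposable S \/ direct_decomposable S -> from_automorphisms S.
Proof.
have [abelG oG] := abelem_Zp2 p_pr isoG.
case; first exact: star_from_automorphisms p_pr abelG oG.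
exact: direct_from_automorphisms p_pr oG.
Qed.
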